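(* For all worms $A$ and $B'$: if $A\vdash_{\mathsf{RC}}B'$, then also $A\vdash_{\mathsf{WC}}B'$.
   Context: Strictly positive formulas are built from the constant $\top$ and propositional variables using the binary connective $\land$ and unary modalities $\langle\alpha\rangle$, one for each ordinal $\alpha$. Worms are the formulas built from $\top$ using only the modalities: $\top$ is a worm, and if $A$ is a worm and $\alpha$ an ordinal then $\langle\alpha\rangle A$ (abbreviated $\alpha A$) is a worm. The final $\top$ is usually not written, and for worms $A,B$ the concatenation $AB$ is the worm obtained by replacing the final $\top$ of $A$ by $B$. $\mathbb{W}_\alpha$ is the class of worms all of whose modalities are $\geq\alpha$ (so $\top\in\mathbb{W}_\alpha$). Reflection Calculus $\mathsf{RC}$: derives sequents $\varphi\vdash_{\mathsf{RC}}\psi$ between strictly positive formulas. Axioms: $\varphi\vdash\varphi$; $\varphi\vdash\top$; $\varphi\land\psi\vdash\varphi$; $\varphi\land\psi\vdash\psi$; $\langle\alpha\rangle\langle\alpha\rangle\varphi\vdash\langle\alpha\rangle\varphi$; $\langle\alpha\rangle\varphi\vdash\langle\beta\rangle\varphi$ for $\alpha>\beta$; $\langle\alpha\rangle\varphi\land\langle\beta\rangle\psi\vdash\langle\alpha\rangle(\varphi\land\langle\beta\rangle\psi)$ for $\alpha>\beta$. Rules: from $\varphi\vdash\psi$ and $\psi\vdash\chi$ infer $\varphi\vdash\chi$; from $\varphi\vdash\psi$ and $\varphi\vdash\chi$ infer $\varphi\vdash\psi\land\chi$; from $\varphi\vdash\psi$ infer $\langle\alpha\rangle\varphi\vdash\langle\alpha\rangle\psi$.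 Worm Calculus $\mathsf{WC}$: derives sequents $A\vdash_{\mathsf{WC}}B$ between worms. Axioms: $A\vdash\top$; $\alpha\alpha A\vdash\alpha A$; $\alpha A\vdash\beta A$ for $\alpha>\beta$. Rules: from $A\vdash B$ and $B\vdash C$ infer $A\vdash C$; from $A\vdash B$ infer $\alpha A\vdash\alpha B$; from $A\vdash B$ and $A\vdash\alpha C$ infer $A\vdash B\alpha C$, provided $B\in\mathbb{W}_{\alpha+1}$. *)

(* Defs.v *)
From HB Require Import structures.
From mathcomp Require Import all_boot all_order boolp.

Set Implicit Arguments.
Unset Strict Implicit.
Unset Printing Implicit Defensive.

Import Order.Theory.
Local Open Scope order_scope.
Local Open Scope quotient_scope.

(* The ordinals of a universe.  The tree [OSup f] denotes the least ordinal
   strictly above every [f i]; comparing trees by the order of the ordinals they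
   denote is a preorder, and [Ord] is the quotient by the induced equivalence,
   so that Leibniz equality on [Ord] is equality of ordinals.  The lemmas
   [Ord_lt_wf], [OrdS_le] and [Ord_sup] below, with the [orderType] instance,
   say that [Ord] is a well-order, that [OrdS a] is a + 1, and that every small
   family of ordinals has a least strict upper bound. *)
Inductive otree : Type := OSup (X : Type) of (X -> otree).

Fixpoint otree_le (a b : otree) : Prop :=
  match a, b with
  | @OSup X f, @OSup Y g => forall i : X, exists j : Y, otree_le (f i) (g j)
  end.

Definition otree_lt (a b : otree) : Prop :=
  match b with @OSup Y g => exists j : Y, otree_le a (g j) end.

Lemma otree_le_refl a : otree_le a a.
Proof. by elim: a => X f IH /= i; exists i. Qed.

Lemma otree_le_trans b a c : otree_le a b -> otree_le b c -> otree_le a c.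
Proof.
elim: a b c => X f IH [Y g] [Z h] /= ab bc i.
have [j ij] := ab i; have [k jk] := bc j.
by exists k; apply: IH ij jk.
Qed.

Lemma otree_leP a b : otree_le a b \/ otree_lt b a.
Proof.
elim: a b => X f IH [Y g].
have [|nle] := pselect (otree_le (OSup f) (OSup g)); first by left.
right; move/existsNP: nle => [i /forallNP ni]; exists i.
have lt_g j : otree_lt (g j) (f i) by case: (IH i (g j)) => // /ni.
by case: (f i) lt_g.
Qed.

Lemma otree_lt_le a b : otree_lt a b -> otree_le a b.
Proof.
elim: a b => X f IH [Y g] /= [j]; case E: (g j) => [Z h] le_fh i.
have [k ik] := le_fh i; exists j; apply: IH.
by rewrite E; exists k.
Qed.

Lemma otree_lt_le_trans b a c : otree_lt a b -> otree_le b c -> otree_lt a c.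
Proof.
case: b c => Y g [Z h] [j aj] bc; have [k jk] := bc j.
by exists k; apply: otree_le_trans jk.
Qed.

Lemma otree_le_lt_trans b a c : otree_le a b -> otree_lt b c -> otree_lt a c.
Proof. by case: c => Z h ab [k bk]; exists k; apply: otree_le_trans bk. Qed.

Lemma otree_lt_irr a : ~ otree_lt a a.
Proof.
elim: a => X f IH [i le_fi]; apply: (IH i).
by apply: otree_lt_le_trans le_fi; exists i; apply: otree_le_refl.
Qed.

Lemma otree_sup_le X (f : X -> otree) b :
  otree_le (OSup f) b <-> forall i, otree_lt (f i) b.
Proof. by case: b. Qed.

HB.instance Definition _ := gen_eqMixin otree.
HB.instance Definition _ := gen_choiceMixin otree.

Definition otree_eqv (a b : otree) : bool :=
  `[< otree_le a b /\ otree_le b a >].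

Lemma otree_eqv_refl : reflexive otree_eqv.
Proof. by move=> a; apply/asboolP; split; apply: otree_le_refl. Qed.

Lemma otree_eqv_sym : symmetric otree_eqv.
Proof. by move=> a b; apply/asboolP/asboolP => -[]. Qed.

Lemma otree_eqv_trans : transitive otree_eqv.
Proof.
move=> b a c /asboolP[ab ba] /asboolP[bc cb]; apply/asboolP.
by split; [apply: otree_le_trans bc | apply: otree_le_trans ba].
Qed.

Canonical otree_equiv_rel :=
  EquivRel otree_eqv otree_eqv_refl otree_eqv_sym otree_eqv_trans.

Definition Ord := {eq_quot otree_equiv_rel}.

HB.instance Definition _ := Choice.on Ord.

Definition Ord_le (a b : Ord) : bool := `[< otree_le (repr a) (repr b) >].

Lemma Ord_le_refl : reflexive Ord_le.
Proof. by move=> a; apply/asboolP/otree_le_refl. Qed.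

Lemma Ord_le_anti : antisymmetric Ord_le.
Proof.
move=> a b /andP[/asboolP ab /asboolP ba].
by rewrite -[a]reprK -[b]reprK; apply/eqmodP/asboolP.
Qed.

Lemma Ord_le_trans : transitive Ord_le.
Proof.
by move=> b a c /asboolP ab /asboolP bc; apply/asboolP/(otree_le_trans ab).
Qed.

Lemma Ord_le_total : total Ord_le.
Proof.
move=> a b; case: (otree_leP (repr a) (repr b)) => [ab|/otree_lt_le ba].
  by apply/orP; left; apply/asboolP.
by apply/orP; right; apply/asboolP.
Qed.

Fact Ord_display : Order.disp_t. Proof. exact: Order.Disp tt tt. Qed.

HB.instance Definition _ :=
  Order.Le_isPOrder.Build Ord_display Ord Ord_le_refl Ord_le_anti Ord_le_trans.
HB.instance Definition _ :=
  Order.POrder_isTotal.Build Ord_display Ord Ord_le_total.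

Definition OrdSup (X : Type) (f : X -> Ord) : Ord :=
  \pi_Ord (OSup (fun i => repr (f i))).

Definition OrdS (a : Ord) : Ord := OrdSup (fun _ : unit => a).

Lemma Ord_leP (a b : Ord) : reflect (otree_le (repr a) (repr b)) (a <= b).
Proof. exact: asboolP. Qed.

Lemma Ord_ltP (a b : Ord) : reflect (otree_lt (repr a) (repr b)) (a < b).
Proof.
rewrite ltNge; apply: (iffP idP) => [/Ord_leP nba|ab].
  by case: (otree_leP (repr b) (repr a)).
by apply/Ord_leP => ba; apply: otree_lt_irr (otree_lt_le_trans ab ba).
Qed.

Lemma repr_pi_eqv t :
  otree_le (repr (\pi_Ord t)) t /\ otree_le t (repr (\pi_Ord t)).
Proof.
have /eqmodP/asboolP[] : repr (\pi_Ord t) = t %[mod Ord] by rewrite reprK.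
by split.
Qed.

Lemma Ord_sup (X : Type) (f : X -> Ord) (b : Ord) :
  OrdSup f <= b <-> forall i, f i < b.
Proof.
have [le1 le2] := repr_pi_eqv (OSup (fun i => repr (f i))).
split=> [/Ord_leP le_b i|lt_b].
  by apply/Ord_ltP; move: i; apply/otree_sup_le; apply: otree_le_trans le_b.
apply/Ord_leP; apply: otree_le_trans le1 _; apply/otree_sup_le => i.
exact/Ord_ltP.
Qed.

Lemma OrdS_le (a b : Ord) : (OrdS a <= b) = (a < b).
Proof. by apply/idP/idP => [/Ord_sup/(_ tt)|ab] //; apply/Ord_sup. Qed.

Lemma Ord_lt_wf : well_founded (fun a b : Ord => a < b).
Proof.
suff acc t : forall a : Ord, otree_le (repr a) t ->
    Acc (fun a b : Ord => a < b) a.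
  by move=> a; apply: acc (otree_le_refl (repr a)).
elim: t => X f IH a le_a; constructor=> b /Ord_ltP lt_ba.
by have [i] := otree_lt_le_trans lt_ba le_a; apply: IH.
Qed.

Inductive formula : Type :=
  | FTop : formula
  | FVar of nat
  | FAnd of formula & formula
  | FDia of Ord & formula.

(* A worm is given by its sequence of modalities: [::] is the worm ⊤, a :: A is
   <a>A, and A ++ B substitutes B for the final ⊤ of A. *)
Definition worm := seq Ord.

Definition formula_of_worm (A : worm) : formula := foldr FDia FTop A.

Coercion formula_of_worm : worm >-> formula.

Definition in_W (a : Ord) (A : worm) : bool := all (fun b : Ord => a <= b) A.

Inductive RC : formula -> formula -> Prop :=
  | RC_id p : RC p p
  | RC_top p : RC p FTop
  | RC_andl p q : RC (FAnd p q) p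
  | RC_andr p q : RC (FAnd p q) q
  | RC_trans4 a p : RC (FDia a (FDia a p)) (FDia a p)
  | RC_mono (a b : Ord) p : b < a -> RC (FDia a p) (FDia b p)
  | RC_J (a b : Ord) p q : b < a ->
      RC (FAnd (FDia a p) (FDia b q)) (FDia a (FAnd p (FDia b q)))
  | RC_cut p q r : RC p q -> RC q r -> RC p r
  | RC_and p q r : RC p q -> RC p r -> RC p (FAnd q r)
  | RC_nec a p q : RC p q -> RC (FDia a p) (FDia a q).

Inductive WC : worm -> worm -> Prop :=
  | WC_top A : WC A [::]
  | WC_trans4 (a : Ord) (A : worm) : WC [:: a, a & A] (a :: A)
  | WC_mono (a b : Ord) (A : worm) : b < a -> WC (a :: A) (b :: A)
  | WC_cut A B C : WC A B -> WC B C -> WC A C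
  | WC_nec (a : Ord) (A B : worm) : WC A B -> WC (a :: A) (a :: B)
  | WC_conc (a : Ord) (A B C : worm) : in_W (OrdS a) B ->
      WC A B -> WC A (a :: C) -> WC A (B ++ a :: C).

(* Main.v *)
(* Worms have binary meets in WC.  Sending variables to ⊤ and conjunctions to
   meets then interprets RC in WC, and this interpretation fixes worms; the only
   axiom that needs an argument is RC_J, <a>p /\ <b>q |- <a>(p /\ <b>q).
   The meet is built by recursion.  If m is the least modality of A and B, write
   A = hA rA with hA in W_(m+1) and rA either ⊤ or starting with m, and likewise
   B = hB rB.  Worms that are ⊤ or start with their least modality m are
   comparable in WC, so A /\ B is (hA /\ hB) r with r the stronger of rA, rB.
   Comparability follows from the linearity of the relations B |- <a>A on W_a. *)

From mathcomp Require Import all_boot all_order boolp.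
Require Import Defs.

Set Implicit Arguments.
Unset Strict Implicit.
Unset Printing Implicit Defensive.

Import Order.Theory.
Local Open Scope order_scope.

(** The shape of a remainder once a head in W_(b+1) has been split off. Any first modality up to [b]
    is allowed, so one split at level [b] serves remainders starting at or below [b]. *)
Definition start_le (b : Ord) (A : worm) : bool :=
  if A is c :: _ then c <= b else true.

Lemma WC_refl A : WC A A.
Proof. by elim: A => [|a A IH]; [apply: WC_top | apply: WC_nec]. Qed.

Lemma WC_le a b A : b <= a -> WC (a :: A) (b :: A).
Proof.
by rewrite le_eqVlt => /predU1P[->|]; [apply: WC_refl | apply: WC_mono].
Qed.

Lemma WC_prefix A B : WC (A ++ B) A.
Proof. by elim: A => [|a A IH]; [apply: WC_top | apply: WC_nec]. Qed.

Lemma in_W_le a b A : a <= b -> in_W b A -> in_W a A.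
Proof. by move=> ab; apply: sub_all => c; apply: le_trans. Qed.

Lemma le_OrdS a b : a <= b -> OrdS a <= OrdS b.
Proof. by move=> ab; rewrite OrdS_le (le_lt_trans ab) // -OrdS_le. Qed.

Lemma le_OrdS_self a : a <= OrdS a.
Proof. by rewrite ltW // -OrdS_le. Qed.

(** If [B] starts with [c], every modality of [A] exceeds [c], so it can be lowered to [c] and
    absorbed by [c c B |- c B]. *)
Lemma WC_suffix b A B : in_W (OrdS b) A -> start_le b B -> WC (A ++ B) B.
Proof.
case: B => [|c B] + cb; first by move=> _; apply: WC_top.
elim: A => [|a A IH] /=; first by move=> _; apply: WC_refl.
rewrite OrdS_le => /andP[ba /IH WAB].
apply: WC_cut (WC_nec _ WAB) _.
exact: WC_cut (WC_mono _ (le_lt_trans cb ba)) (WC_trans4 _ _).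
Qed.

Lemma WC_cat b A B D :
  in_W (OrdS b) A -> start_le b B -> WC D A -> WC D B -> WC D (A ++ B).
Proof.
case: B => [|c B]; first by rewrite cats0.
by move=> WA cb DA DB; apply: WC_conc => //; apply: in_W_le WA; apply: le_OrdS.
Qed.

Lemma worm_split b (A : worm) :
  exists H R : worm, [/\ A = H ++ R, in_W (OrdS b) H & start_le b R].
Proof.
elim: A => [|a A [H [R [-> WH bR]]]]; first by exists [::], [::].
have [ab|ba] := leP a b; first by exists [::], (a :: H ++ R).
by exists (a :: H), R; split => //=; rewrite OrdS_le ba.
Qed.

Lemma exists_min_modality (A : worm) :
  A != [::] -> exists2 m, m \in A & in_W m A.
Proof.
elim: A => // a A IH _; have [->|/IH[m mA WA]] := eqVneq A [::].
  by exists a; rewrite ?mem_head //= lexx.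
have [am|ma] := leP a m; last by exists m; rewrite ?inE ?mA ?orbT //= (ltW ma).
by exists a; rewrite ?mem_head //= lexx (in_W_le am).
Qed.

Lemma notin_W m A : in_W (OrdS m) A -> m \notin A.
Proof. by move=> /allP WA; apply/negP => /WA; rewrite OrdS_le ltxx. Qed.

Lemma start_min m A :
  start_le m A -> in_W m A -> A = [::] \/ exists A', A = m :: A'.
Proof.
case: A => [|c A] /= cm; first by left.
by case/andP=> mc _; right; exists A; rewrite (@le_anti _ _ c m) ?cm.
Qed.

(** Lets induction on total length pass to the heads: [m] occurs in neither head, so some remainder
    is nonempty. *)
Lemma size_heads_lt m (HA RA HB RB : worm) :
  m \in (HA ++ RA) ++ (HB ++ RB) -> in_W (OrdS m) HA -> in_W (OrdS m) HB ->
  (size (HA ++ HB) < size ((HA ++ RA) ++ (HB ++ RB)))%N.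
Proof.
move=> + /notin_W/negbTE nA /notin_W/negbTE nB.
rewrite !mem_cat nA nB /= !size_cat addnACA -[X in (X < _)%N]addn0 ltn_add2l.
by case: RA => //; case: RB.
Qed.

(** Induction on total length, with [m] the least modality. Either comparing a remainder with the
    other worm decides, or each worm proves the other's remainder and comparing the heads at level
    m+1 decides. *)
Lemma WC_linear a (A B : worm) : in_W a A -> in_W a B ->
  [\/ WC A (a :: B), WC B (a :: A) | WC A B /\ WC B A].
Proof.
have [n] := ubnP (size (A ++ B)); elim: n a A B => // n IH a A B ltn WA WB.
have [/eqP|/exists_min_modality[m mAB]] := eqVneq (A ++ B) [::].
  rewrite -size_eq0 size_cat addn_eq0 !size_eq0 => /andP[/eqP-> /eqP->].
  by constructor 3; split; apply: WC_top.
rewrite {1}/in_W all_cat => /andP[WmA WmB].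
have am : a <= m.
  by move: mAB; rewrite mem_cat => /orP[]; [move/(allP WA) | move/(allP WB)].
suff [W|W|W] : [\/ WC A (m :: B), WC B (m :: A) | WC A B /\ WC B A].
- by constructor 1; apply: WC_cut W (WC_le _ am).
- by constructor 2; apply: WC_cut W (WC_le _ am).
- by constructor 3.
(* When [R] is [m :: R'], induction applies to the shorter pair [R'], [D]. If [R'] proves [m :: D]
   or is equivalent to [D], then [C |- R |- m D]; otherwise [D |- m R'], which is [R]. *)
have tail C D R H : (size (C ++ D) < n.+1)%N -> C = H ++ R ->
    in_W (OrdS m) H -> start_le m R -> in_W m C -> in_W m D ->
    WC C (m :: D) \/ WC D R.
  move=> ltCD EC WH mR WC_ WD; have CR : WC C R.
    by rewrite EC; apply: WC_suffix WH mR.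
  have WR : in_W m R by move: WC_; rewrite EC /in_W all_cat => /andP[].
  have [R0|[R' ER]] := start_min mR WR.
    by right; rewrite R0; apply: WC_top.
  have WR' : in_W m R' by move: WR; rewrite ER /= => /andP[].
  have [|W|W|[W _]] := IH m R' D _ WR' WD.
  - apply: leq_trans (_ : size (C ++ D) <= n)%N; last by rewrite -ltnS.
    by rewrite EC ER !size_cat /= ltn_add2r addnS ltnS leq_addl.
  - left; apply: WC_cut CR _; rewrite ER.
    exact: WC_cut (WC_nec _ W) (WC_trans4 _ _).
  - by right; rewrite ER.
  - by left; apply: WC_cut CR _; rewrite ER; apply: WC_nec.
have [HA [RA [EA WHA mRA]]] := worm_split m A.
have [HB [RB [EB WHB mRB]]] := worm_split m B.
have [W|BRA] := tail A B RA HA ltn EA WHA mRA WmA WmB; first by constructor 1.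
have [|W|ARB] := tail B A RB HB _ EB WHB mRB WmB WmA.
- by rewrite size_cat addnC -size_cat.
- by constructor 2.
have AHA : WC A HA by rewrite EA; apply: WC_prefix.
have BHB : WC B HB by rewrite EB; apply: WC_prefix.
(* The worm [OrdS m :: H] is still in W_(m+1), so [R] can be appended to it before its first
   modality is lowered to [m]. *)
have head C D H R : C = H ++ R -> in_W (OrdS m) H -> start_le m R ->
    WC D (OrdS m :: H) -> WC D R -> WC D (m :: C).
  move=> -> WH mR DH DR; apply: WC_cut (WC_le _ (le_OrdS_self m)).
  by rewrite -cat_cons; apply: WC_cat mR _ DR => //=; rewrite lexx.
have lt_heads : (size (HA ++ HB) < n)%N.
  apply: leq_trans (_ : size (A ++ B) <= n)%N; last by rewrite -ltnS.
  by rewrite EA EB; apply: (@size_heads_lt m) => //; rewrite -EA -EB.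
have [W|W|[WAB WBA]] := IH (OrdS m) HA HB lt_heads WHA WHB.
- by constructor 1; apply: (head B A HB RB) => //; apply: WC_cut AHA W.
- by constructor 2; apply: (head A B HA RA) => //; apply: WC_cut BHB W.
constructor 3; split.
- by rewrite EB; apply: WC_cat WHB mRB _ ARB; apply: WC_cut AHA WAB.
- by rewrite EA; apply: WC_cat WHA mRA _ BRA; apply: WC_cut BHB WBA.
Qed.

(** Removing the leading [m] from both worms reduces this to linearity on W_m, where a doubled [m]
    is absorbed. *)
Lemma WC_comparable m (A B : worm) :
  start_le m A -> start_le m B -> in_W m A -> in_W m B -> WC A B \/ WC B A.
Proof.
move=> mA mB WA WB.
have [->|[A' EA]] := start_min mA WA; first by right; apply: WC_top.
have [->|[B' EB]] := start_min mB WB; first by left; apply: WC_top.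
move: WA WB; rewrite EA EB /= => /andP[_ WA] /andP[_ WB].
have [W|W|[W _]] := WC_linear WA WB.
- by left; apply: WC_cut (WC_nec _ W) (WC_trans4 _ _).
- by right; apply: WC_cut (WC_nec _ W) (WC_trans4 _ _).
- by left; apply: WC_nec.
Qed.

Definition is_meet (A B C : worm) : Prop :=
  [/\ WC C A, WC C B & forall D, WC D A -> WC D B -> WC D C].

(* The last clause lets a meet of two worms be appended to a head in W_(b+1);
   this is what RC_J requires. *)
Lemma exists_meet (A B : worm) :
  exists C : worm, [/\ is_meet A B C, {subset C <= A ++ B} &
    forall b, start_le b A -> start_le b B -> start_le b C].
Proof.
have [n] := ubnP (size (A ++ B)); elim: n A B => // n IH A B ltn.
have [/eqP|/exists_min_modality[m mAB]] := eqVneq (A ++ B) [::].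
  rewrite -size_eq0 size_cat addn_eq0 !size_eq0 => /andP[/eqP-> /eqP->].
  by exists [::]; split => //; split=> *; apply: WC_top.
rewrite {1}/in_W all_cat => /andP[WmA WmB].
have [HA [RA [EA WHA mRA]]] := worm_split m A.
have [HB [RB [EB WHB mRB]]] := worm_split m B.
have lt_heads : (size (HA ++ HB) < n)%N.
  apply: leq_trans (_ : size (A ++ B) <= n)%N; last by rewrite -ltnS.
  by rewrite EA EB; apply: (@size_heads_lt m) => //; rewrite -EA -EB.
have [H [[HHA HHB Hmax] subH startH]] := IH HA HB lt_heads.
(* The inclusion clause keeps the meet of the heads in W_(m+1), so that a remainder can follow
   it. *)
have WH : in_W (OrdS m) H.
  apply/allP => c /subH; rewrite mem_cat => /orP[].
    exact: (allP WHA).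
  exact: (allP WHB).
have [WRA WRB] : in_W m RA /\ in_W m RB.
  move: WmA WmB; rewrite EA EB /in_W !all_cat.
  by move=> /andP[_ ->] /andP[_ ->].
have [R [mR RRA RRB ER]] : exists R : worm,
    [/\ start_le m R, WC R RA, WC R RB & R = RA \/ R = RB].
  have [W|W] := WC_comparable mRA mRB WRA WRB.
    by exists RA; split; [| apply: WC_refl | | left].
  by exists RB; split; [| | apply: WC_refl | right].
have CH : WC (H ++ R) H by apply: WC_prefix.
have CR : WC (H ++ R) R by apply: WC_suffix WH mR.
exists (H ++ R); split; first split.
- rewrite EA; apply: WC_cat WHA mRA _ _.
    exact: WC_cut CH HHA.
  exact: WC_cut CR RRA.
- rewrite EB; apply: WC_cat WHB mRB _ _.
    exact: WC_cut CH HHB.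
  exact: WC_cut CR RRB.
- move=> D DA DB; apply: WC_cat WH mR _ _.
    apply: Hmax; first by apply: WC_cut DA _; rewrite EA; apply: WC_prefix.
    by apply: WC_cut DB _; rewrite EB; apply: WC_prefix.
  case: ER => ->.
    by apply: WC_cut DA _; rewrite EA; apply: WC_suffix WHA mRA.
  by apply: WC_cut DB _; rewrite EB; apply: WC_suffix WHB mRB.
- move=> c; rewrite mem_cat EA EB !mem_cat => /orP[/subH|].
    by rewrite mem_cat => /orP[] ->; rewrite ?orbT.
  by case: ER => -> ->; rewrite ?orbT.
move=> b bA bB.
(* Some worm is nonempty; its first modality is at least [m] and at most [b]. *)
have mb : m <= b.
  case: A B mAB bA bB WmA WmB {ltn EA EB} => [|a A] [|c B] //= _.
  - by move=> _ cb _ /andP[mc _]; apply: le_trans mc cb.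
  - by move=> ab _ /andP[ma _] _; apply: le_trans ma ab.
  - by move=> ab _ /andP[ma _] _; apply: le_trans ma ab.
have start_prefix C D : start_le b (C ++ D) -> start_le b C by case: C.
have bHA : start_le b HA by apply: (@start_prefix _ RA); rewrite -EA.
have bHB : start_le b HB by apply: (@start_prefix _ RB); rewrite -EB.
have bH := startH b bHA bHB.
case: (H) bH => //= _; case: (R) mR => //= c _ cm; exact: le_trans cm mb.
Qed.

Definition meet (A B : worm) : worm := projT1 (cid (exists_meet A B)).

Lemma meetP A B : is_meet A B (meet A B).
Proof. by rewrite /meet; case: (cid _) => C /= []. Qed.

Lemma meet_start b A B :
  start_le b A -> start_le b B -> start_le b (meet A B).
Proof. by rewrite /meet; case: (cid _) => C /= [_ _]; apply. Qed.

(** Split [A] as [H ++ R] at level [b]. As [b < a], [a :: H] is still in W_(b+1), and the meet [M]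
    of [R] and [b :: B] is ⊤ or starts at or below [b]. Hence the left side proves [a :: (H ++ M)],
    while [H ++ M] proves both [A] and [b :: B]. *)
Lemma WC_J a b (A B : worm) :
  b < a -> WC (meet (a :: A) (b :: B)) (a :: meet A (b :: B)).
Proof.
move=> ba; have [] := meetP (a :: A) (b :: B).
set D := meet (a :: A) _ => DA DB _.
have [H [R [EA WH bR]]] := worm_split b A.
have WaH : in_W (OrdS b) (a :: H) by rewrite /= OrdS_le ba.
have [MR MB maxM] := meetP R (b :: B).
have bM : start_le b (meet R (b :: B)) by apply: meet_start => //=.
set M := meet R _ in MR MB maxM bM.
have DM : WC D M.
  apply: maxM => //; apply: WC_cut DA _.
  by rewrite EA -cat_cons; apply: WC_suffix WaH bR.
have DaHM : WC D (a :: (H ++ M)).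
  rewrite -cat_cons; apply: WC_cat WaH bM _ DM; apply: WC_cut DA _.
  by rewrite EA -cat_cons; apply: WC_prefix.
apply: WC_cut DaHM _; apply: WC_nec.
have HMM : WC (H ++ M) M by apply: WC_suffix WH bM.
have [_ _] := meetP A (b :: B); apply; last exact: WC_cut HMM MB.
rewrite EA; apply: WC_cat WH bR _ _; first exact: WC_prefix.
exact: WC_cut HMM MR.
Qed.

Fixpoint worm_of (p : formula) : worm :=
  match p with
  | FTop => [::]
  | FVar _ => [::]
  | FAnd p q => meet (worm_of p) (worm_of q)
  | FDia a p => a :: worm_of p
  end.

Lemma worm_ofK (A : worm) : worm_of A = A.
Proof. by elim: A => //= a A ->. Qed.

Lemma RC_WC p q : RC p q -> WC (worm_of p) (worm_of q).
Proof.
elim=> {p q} /=.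
- by move=> p; apply: WC_refl.
- by move=> p; apply: WC_top.
- by move=> p q; have [] := meetP (worm_of p) (worm_of q).
- by move=> p q; have [] := meetP (worm_of p) (worm_of q).
- by move=> a p; apply: WC_trans4.
- by move=> a b p; apply: WC_mono.
- by move=> a b p q; apply: WC_J.
- by move=> p q r _ pq _; apply: WC_cut pq.
- move=> p q r _ pq _ pr.
  by have [_ _] := meetP (worm_of q) (worm_of r); apply.
- by move=> a p q _; apply: WC_nec.
Qed.

Theorem theorem6p1 (A B' : worm) : RC A B' -> WC A B'.
Proof. by move/RC_WC; rewrite !worm_ofK. Qed.
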